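(* Let $P(\lambda)$ be a regular $n\times n$ complex matrix polynomial, $\Gamma$ a closed contour in the complex plane, $u\in\mathbb{C}^n$ an arbitrary vector and $v\in\mathbb{C}^n$ a nonzero vector. Suppose that $P(\lambda)$ has exactly $m$ eigenvalues in the interior of $\Gamma$, namely, distinct eigenvalues $\lambda_0,\ldots,\lambda_s$ with algebraic multiplicities $m_0,\ldots,m_s$, respectively, such that $m=m_0+\cdots+m_s$. Moreover, assume that no eigenvalue of $P(\lambda)$ lies exactly on the contour $\Gamma$, and that the geometric multiplicity of $\lambda_i$ is equal to one for every $i=0,\ldots,s$. Let $S=[s_0,s_1,\ldots,s_{m-1}]$ and $C=H_0^{-1}H_1$. Then the pair $(S,C)$ satisfies $P(S,C)=0$, i.e., $(S,C)$ is a simple invariant pair for $P(\lambda)$.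
   Context: $P(\lambda)=\sum_{j=0}^\ell A_j\lambda^j$, with $A_j\in\mathbb{C}^{n\times n}$ and $A_\ell\ne0$, is regular if $\det P(\lambda)$ does not vanish identically. The algebraic multiplicity of an eigenvalue $\lambda_0$ of $P(\lambda)$ is its multiplicity as a root of $\det P(\lambda)$; its geometric multiplicity is the dimension of the null space of $P(\lambda_0)$. Define $$\mu_k=\frac{1}{2\pi\imath}\oint_\Gamma z^k\,u^HP(z)^{-1}v\,dz,\qquad s_k=\frac{1}{2\pi\imath}\oint_\Gamma z^kP(z)^{-1}v\,dz\in\mathbb{C}^n,\qquad k=0,1,\ldots,$$ and the $m\times m$ Hankel matrices $H_0=[\mu_{i+j}]_{i,j=0}^{m-1}$, $H_1=[\mu_{i+j+1}]_{i,j=0}^{m-1}$. For $(X,T)\in\mathbb{C}^{n\times k}\times\mathbb{C}^{k\times k}$ put $P(X,T):=\sum_{j=0}^\ell A_jXT^j$. The pair $(X,T)$, with $X\neq0$ and $1\le k\le\ell n$, is an invariant pair for $P(\lambda)$ if $P(X,T)=0$. It is minimal if for some $r\in\mathbb{N}$ the matrix obtained by stacking $XT^{r-1},\ldots,XT,X$ vertically has full column rank. An invariant pair is simple if it is minimal and the algebraic multiplicities of the eigenvalues of $T$ are identical to those of the corresponding eigenvalues of $P(\lambda)$.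
   Formalization: The formal statement assumes that H_0 is nonsingular; for arbitrary u (for example u = 0, where H_0 = 0) the matrix C = H_0^{-1}H_1 is otherwise undefined. *)

(* Defs.v *)
From HB Require Import structures.
From mathcomp Require Import all_boot all_order all_algebra complex.
From mathcomp Require Import all_classical all_reals all_analysis.

Set Implicit Arguments.
Unset Strict Implicit.
Unset Printing Implicit Defensive.

Import Order.TTheory GRing.Theory Num.Theory.
Import numFieldNormedType.Exports.

Local Open Scope classical_set_scope.
Local Open Scope ring_scope.

Section MatrixPolynomials.
Context {R : realType} {n l : nat}.
Implicit Types (A : 'I_l.+1 -> 'M[R[i]]_n) (z : R[i]).

(* The family A stands for P(x) = \sum_(j <= l) A_j x^j. *)
Definition mpoly_mx A : 'M[{poly R[i]}]_n :=
  \sum_(j < l.+1) 'X^j *: map_mx polyC (A j).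

Definition mpoly_eval A z : 'M[R[i]]_n := \sum_(j < l.+1) z ^+ j *: A j.

Definition mpoly_regular A : Prop := \det (mpoly_mx A) != 0.

Definition mpoly_eigenvalue A z : Prop := root (\det (mpoly_mx A)) z.

Definition alg_mult A z : nat := mup z (\det (mpoly_mx A)).

(* The columns of cokermx M span the null space {x | M *m x = 0}; kermx would
   give the left null space. *)
Definition geom_mult A z : nat := \rank (cokermx (mpoly_eval A z)).

Definition mpoly_pair A k (X : 'M[R[i]]_(n, k)) (T : 'M[R[i]]_k) :
  'M[R[i]]_(n, k) := \sum_(j < l.+1) A j *m X *m T ^+ j.

Definition invariant_pair A k (X : 'M[R[i]]_(n, k)) (T : 'M[R[i]]_k) : Prop :=
  [/\ X != 0, (1 <= k <= l * n)%N & mpoly_pair A X T = 0].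

(* The blocks are X T^(r-1), ..., X T, X, from top to bottom. *)
Definition minimal_pair k (X : 'M[R[i]]_(n, k)) (T : 'M[R[i]]_k) : Prop :=
  exists r : nat, \rank (\mxcol_(i < r) (X *m T ^+ (r.-1 - i))) = k.

Definition simple_invariant_pair A k (X : 'M[R[i]]_(n, k))
    (T : 'M[R[i]]_k) : Prop :=
  [/\ invariant_pair A X T, minimal_pair X T &
      forall z, eigenvalue T z -> mup z (char_poly T) = alg_mult A z].

End MatrixPolynomials.

Section Contours.
Context {R : realType}.

(* C^1 up to the endpoints: the derivative on ]a, b[ extends continuously to
   [a, b]. *)
Definition C1_on (g : R -> R) (a b : R) : Prop :=
  {within `[a, b], continuous g} /\
  exists2 g' : R -> R, {within `[a, b], continuous g'} &
    forall x, x \in `]a, b[ -> is_derive x (1 : R) g (g' x).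

Definition piecewise_C1 (gamma : R -> R[i]) (a b : R) : Prop :=
  exists (N : nat) (t : nat -> R),
    [/\ t 0%N = a, t N = b &
        forall i, (i < N)%N ->
          [/\ t i < t i.+1,
              C1_on (fun x => complex.Re (gamma x)) (t i) (t i.+1) &
              C1_on (fun x => complex.Im (gamma x)) (t i) (t i.+1)]].

Record closed_contour := ClosedContour {
  contour_fun :> R -> R[i];
  contour_lo : R;
  contour_hi : R;
  contour_lt : contour_lo < contour_hi;
  contour_closed : contour_fun contour_lo = contour_fun contour_hi;
  contour_piecewise_C1 : piecewise_C1 contour_fun contour_lo contour_hi }.

(* R[i]^o carries the usual topology of the complex plane. *)
Definition contour_image (G : closed_contour) : set R[i]^o :=
  [set G t | t in `[contour_lo G, contour_hi G]].

(* The union of the bounded components of the complement of the contour: the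
   interior in the sense of the Jordan curve theorem when the contour is
   simple. *)
Definition contour_interior (G : closed_contour) : set R[i]^o :=
  [set z | ~ contour_image G z /\
           bounded_set (connected_component (~` contour_image G) z)].

(* derive1 takes arbitrary values at the finitely many breakpoints; this does
   not affect the integral below. *)
Definition contour_deriv (G : closed_contour) (t : R) : R[i] :=
  Complex (derive1 (fun x => complex.Re (G x)) t)
          (derive1 (fun x => complex.Im (G x)) t).

Definition contour_integral (G : closed_contour) (f : R[i] -> R[i]) : R[i] :=
  let D := [set` `[contour_lo G, contour_hi G]] in
  let h t := f (G t) * contour_deriv G t in
  Complex (\int[lebesgue_measure]_(t in D) complex.Re (h t))
          (\int[lebesgue_measure]_(t in D) complex.Im (h t)).

Definition two_pi_i : R[i] := Complex 0 (2 * pi).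

End Contours.
Arguments closed_contour : clear implicits.

Section Moments.
Context {R : realType} {n l : nat}.
Variables (A : 'I_l.+1 -> 'M[R[i]]_n) (G : closed_contour R).

Definition scalar_moment (u v : 'cV[R[i]]_n) (k : nat) : R[i] :=
  two_pi_i^-1 * contour_integral G
    (fun z => z ^+ k *
       (map_mx conjc u^T *m invmx (mpoly_eval A z) *m v) ord0 ord0).

Definition vector_moment (v : 'cV[R[i]]_n) (k : nat) : 'cV[R[i]]_n :=
  \col_i (two_pi_i^-1 * contour_integral G
    (fun z => (z ^+ k *: (invmx (mpoly_eval A z) *m v)) i ord0)).

Definition hankel0 (m : nat) (u v : 'cV[R[i]]_n) : 'M[R[i]]_m :=
  \matrix_(i, j) scalar_moment u v (i + j).

Definition hankel1 (m : nat) (u v : 'cV[R[i]]_n) : 'M[R[i]]_m :=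
  \matrix_(i, j) scalar_moment u v (i + j).+1.

Definition moment_mx (m : nat) (v : 'cV[R[i]]_n) : 'M[R[i]]_(n, m) :=
  \matrix_(i < n, k < m) vector_moment v k i ord0.

End Moments.

(* Main.v *)
Require Import Defs.
From HB Require Import structures.
From mathcomp Require Import all_boot all_order all_algebra complex.
From mathcomp Require Import perm.
From mathcomp Require Import all_classical all_reals all_analysis.
From mathcomp Require Import measurable_realfun.
From mathcomp Require Import ring zify.

Set Implicit Arguments.
Unset Strict Implicit.
Unset Printing Implicit Defensive.

Import Order.TTheory GRing.Theory Num.Theory.
Import numFieldNormedType.Exports.
Import Normc.

Local Open Scope classical_set_scope.
Local Open Scope ring_scope.

(** Write [d] for the determinant of the matrix polynomial P. On the contour the
    resolvent is adj(P)/d, so s_k and mu_k are contour integrals of rational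
    functions. Factor d = D E, where D is the monic product of the factors z - r
    over the roots r of d equal to some lambda_i, counted with multiplicity; D has
    degree m.

    Two facts determine everything. Multiplying the integrand by D removes all
    the poles in the interior, so that the integral vanishes by Cauchy's theorem:
    the sequence (s_k) satisfies the linear recurrence with characteristic
    polynomial D ([vector_moment_recD]). Multiplying the resolvent by P leaves a
    polynomial, so that sum_j A_j s_(j+k) = 0 ([vector_moment_recA]).

    The recurrence says that H_1 = H_0 C', where C' is the transpose of the
    companion matrix of D ([shift_hankelS]); hence C = C'. Right multiplication
    by C' shifts the columns of S, so S C^j has columns s_j, ..., s_(j+m-1), and
    P(S, C) = 0 is the second fact. The characteristic polynomial of C is D, which
    gives the multiplicities. Finally u^H S C^i is row i of H_0, so the stack of
    the blocks S C^i has full column rank because H_0 is invertible.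

    Cauchy's theorem is needed only for rational functions, with the interior
    defined as the union of the bounded components of the complement of the
    contour. The remaining poles lie in unbounded components, and it suffices that
    int dz/(z - r) vanishes there ([winding_integral_exterior]). This integral is
    locally constant in r and vanishes for large r, both by a geometric expansion
    whose terms are exact. Higher order poles and polynomials have primitives,
    and [contour_integral_exterior_poles] reduces a general rational function to
    these cases. *)

(** * Integrals of piecewise continuous functions *)

Lemma integrable_disjU d (T : measurableType d) (R : realType)
    (mu : {measure set T -> \bar R}) (A B : set T) (f : T -> \bar R) :
  measurable A -> measurable B -> [disjoint A & B] ->
  mu.-integrable A f -> mu.-integrable B f -> mu.-integrable (A `|` B) f.
Proof.
move=> mA mB AB /integrableP[mfA iA] /integrableP[mfB iB].
have mf := (measurable_funU f mA mB).2 (conj mfA mfB).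
apply/integrableP; split=> //.
rewrite ge0_integral_setU//; first exact: lte_add_pinfty.
exact: measurableT_comp.
Qed.

Section PiecewiseIntegral.
Context {R : realType}.
Local Notation mu := (@lebesgue_measure R).

Lemma continuous_itv_integrable (a b : R) (f : R -> R) :
  {within `[a, b], continuous f} -> mu.-integrable `[a, b] (EFin \o f).
Proof.
by move=> cf; apply: continuous_compact_integrable => //; exact: segment_compact.
Qed.

Lemma integrable_set1 (x : R) (f : R -> \bar R) : mu.-integrable [set x] f.
Proof.
apply: null_set_integrable => //; first exact: measurable_fun_set1.
exact: lebesgue_measure_set1.
Qed.

(** The values of [h] at the breakpoints are arbitrary, so integrability of [h] on
    the whole interval has to be glued from the pieces together with it: a single
    point is null, and each open piece inherits integrability from [k i]. *)
Lemma Rintegral_pieces (h : R -> R) (k : nat -> R -> R) (t : nat -> R) (N : nat) :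
  (forall i, (i < N)%N -> t i < t i.+1) ->
  (forall i, (i < N)%N -> {within `[t i, t i.+1], continuous (k i)}) ->
  (forall i, (i < N)%N -> {in `]t i, t i.+1[, h =1 k i}) ->
  [/\ t 0%N <= t N, mu.-integrable `[t 0%N, t N] (EFin \o h) &
  \int[mu]_(x in `[t 0%N, t N]) h x =
    \sum_(i < N) \int[mu]_(x in `[t i, t i.+1]) k i x].
Proof.
elim: N => [|N IH] tlt ck hk.
  rewrite set_itv1 big_ord0 Rintegral_set1; split => //.
  exact: integrable_set1.
have [t0N iN eN] := IH (fun i iN => tlt i (ltnW iN)) (fun i iN => ck i (ltnW iN))
  (fun i iN => hk i (ltnW iN)).
have tN := tlt N (ltnSn _).
have ikN := continuous_itv_integrable (ck N (ltnSn _)).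
have ihoo : mu.-integrable `]t N, t N.+1[ (EFin \o h).
  apply: (@eq_integrable _ _ _ mu `]t N, t N.+1[%classic _ (EFin \o k N)) => //.
    by move=> x; rewrite inE => /= xt; rewrite (hk N).
  by apply: integrableS ikN => //; exact: subset_itv_oo_cc.
have ihoc : mu.-integrable `]t N, t N.+1] (EFin \o h).
  
  rewrite -(setUitv1 true) ?bnd_simp//.
  apply: integrable_disjU => //.
    apply/disj_setPS => x [/=]; rewrite in_itv/= => /andP[_ xt] xe.
    by rewrite xe ltxx in xt.
  exact: integrable_set1.
have E : `[t 0%N, t N.+1]%classic =
    `[t 0%N, t N]%classic `|` `]t N, t N.+1]%classic :> set R.
  by rewrite -itv_bndbnd_setU ?bnd_simp// ltW.
have dj : [disjoint `[t 0%N, t N]%classic & `]t N, t N.+1]%classic].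
  apply/disj_setPS => x [/=]; rewrite !in_itv/= => /andP[_ xt] /andP[].
  by rewrite ltNge xt.
have iU : mu.-integrable `[t 0%N, t N.+1] (EFin \o h).
  by rewrite E; exact: integrable_disjU.
split => //; first exact: le_trans t0N (ltW tN).
rewrite E Rintegral_setU -?E// eN big_ord_recr/=; congr (_ + _).
rewrite -Rintegral_itv_bndo_bndc// -[RHS]Rintegral_itv_bndo_bndc; last first.
  by apply: integrableS ikN => //; apply: subset_itvl; rewrite bnd_simp.
rewrite -[RHS]Rintegral_itv_obnd_cbnd; last first.
  by apply: integrableS ikN => //; exact: subset_itv_oo_cc.
by apply: eq_Rintegral => x; rewrite inE/= => /hk ->.
Qed.

End PiecewiseIntegral.

(** * Componentwise calculus of complex functions of a real variable *)

Section ComplexCalculus.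
Context {R : realType}.
Implicit Types (a b : R) (h k : R -> R[i]).

(** Continuity of a complex function of a real variable is used only through its
    components, which keeps every integral and derivative real. *)
Definition ccont a b h :=
  {within `[a, b], continuous (fun t => complex.Re (h t))} /\
  {within `[a, b], continuous (fun t => complex.Im (h t))}.

Definition cderiv h (x : R) (d : R[i]) :=
  is_derive x (1 : R) (fun t => complex.Re (h t)) (complex.Re d) /\
  is_derive x (1 : R) (fun t => complex.Im (h t)) (complex.Im d).

Definition cint a b h : R[i] :=
  Complex (\int[lebesgue_measure]_(t in `[a, b]) complex.Re (h t))
          (\int[lebesgue_measure]_(t in `[a, b]) complex.Im (h t)).

Lemma cReD (x y : R[i]) : complex.Re (x + y) = complex.Re x + complex.Re y.
Proof. by case: x y => ? ? []. Qed.
Lemma cImD (x y : R[i]) : complex.Im (x + y) = complex.Im x + complex.Im y.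
Proof. by case: x y => ? ? []. Qed.
Lemma cReM (x y : R[i]) : complex.Re (x * y) =
  complex.Re x * complex.Re y - complex.Im x * complex.Im y.
Proof. by case: x y => ? ? []. Qed.
Lemma cImM (x y : R[i]) : complex.Im (x * y) =
  complex.Re x * complex.Im y + complex.Im x * complex.Re y.
Proof. by case: x y => ? ? []. Qed.
Lemma cReV (x : R[i]) : complex.Re x^-1 =
  complex.Re x * (complex.Re x * complex.Re x + complex.Im x * complex.Im x)^-1.
Proof. by case: x => ? ?; rewrite -!expr2. Qed.
Lemma cImV (x : R[i]) : complex.Im x^-1 =
  - complex.Im x * (complex.Re x * complex.Re x + complex.Im x * complex.Im x)^-1.
Proof. by case: x => ? ?; rewrite -!expr2 /= mulNr. Qed.

Lemma sqr_Re_Im_neq0 (x : R[i]) : x != 0 ->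
  complex.Re x * complex.Re x + complex.Im x * complex.Im x != 0.
Proof.
by case: x => x y; rewrite eq_complex/= -!expr2 paddr_eq0 ?sqr_ge0// !sqrf_eq0.
Qed.

Lemma ccontS a b c d h : a <= c -> d <= b -> ccont a b h -> ccont c d h.
Proof.
move=> ac db [hr hi].
have s : `[c, d]%classic `<=` `[a, b]%classic by apply: subset_itvScc; rewrite bnd_simp.
by split; [apply: continuous_subspaceW s hr|apply: continuous_subspaceW s hi].
Qed.

Lemma ccont_cst a b (z : R[i]) : ccont a b (fun=> z).
Proof. by split => x; exact: cvg_cst. Qed.

Lemma ccontP a b h (hr hi : R -> R) :
  (forall t, complex.Re (h t) = hr t) -> (forall t, complex.Im (h t) = hi t) ->
  {within `[a, b], continuous hr} -> {within `[a, b], continuous hi} -> ccont a b h.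
Proof.
by move=> /funext er /funext ei cr ci; rewrite /ccont er ei.
Qed.

Lemma ccontD a b h k : ccont a b h -> ccont a b k -> ccont a b (fun t => h t + k t).
Proof.
move=> [hr hi] [kr ki].
apply: ccontP => [t|t| |]; [exact: cReD|exact: cImD| |] => x.
- by apply: continuousD; [exact: hr|exact: kr].
- by apply: continuousD; [exact: hi|exact: ki].
Qed.

Lemma ccontM a b h k : ccont a b h -> ccont a b k -> ccont a b (fun t => h t * k t).
Proof.
move=> [hr hi] [kr ki].
apply: ccontP => [t|t| |]; [exact: cReM|exact: cImM| |] => x.
- by apply: cvgB; apply: cvgM; [exact: hr|exact: kr|exact: hi|exact: ki].
- by apply: cvgD; apply: cvgM; [exact: hr|exact: ki|exact: hi|exact: kr].
Qed.

Lemma ccontV a b h : {in `[a, b], forall t, h t != 0} -> ccont a b h ->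
  ccont a b (fun t => (h t)^-1).
Proof.
move=> h0 [hr hi].
have cV : {within `[a, b], continuous (fun t => (complex.Re (h t) * complex.Re (h t) +
    complex.Im (h t) * complex.Im (h t))^-1)}.
  apply/subspace_continuousP => x xab; apply: cvgV.
    by apply: sqr_Re_Im_neq0; apply: h0.
  by apply: cvgD; apply: cvgM; move: x xab; exact/subspace_continuousP.
apply: ccontP => [t|t| |]; [exact: cReV|exact: cImV| |] => x.
- by apply: cvgM; [exact: hr|exact: cV].
- by apply: cvgM; [apply: cvgN; exact: hi|exact: cV].
Qed.

Lemma cderiv_cst (z : R[i]) x : cderiv (fun=> z) x 0.
Proof. by split; exact: is_derive_cst. Qed.

Lemma cderivP (hr hi : R -> R) h x d :
  (forall t, complex.Re (h t) = hr t) -> (forall t, complex.Im (h t) = hi t) ->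
  is_derive x (1 : R) hr (complex.Re d) -> is_derive x (1 : R) hi (complex.Im d) ->
  cderiv h x d.
Proof.
by move=> /funext er /funext ei cr ci; rewrite /cderiv er ei.
Qed.

Lemma cderivD h k x d e : cderiv h x d -> cderiv k x e ->
  cderiv (fun t => h t + k t) x (d + e).
Proof.
move=> [hr hi] [kr ki].
apply: (@cderivP (fun t => complex.Re (h t) + complex.Re (k t))
                 (fun t => complex.Im (h t) + complex.Im (k t))) => [t|t| |].
- exact: cReD.
- exact: cImD.
- by rewrite cReD; exact: is_deriveD.
- by rewrite cImD; exact: is_deriveD.
Qed.

Lemma cderivM h k x d e : cderiv h x d -> cderiv k x e ->
  cderiv (fun t => h t * k t) x (d * k x + h x * e).
Proof.
move=> [hr hi] [kr ki].
apply: (@cderivP (fun t => complex.Re (h t) * complex.Re (k t) -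
                             complex.Im (h t) * complex.Im (k t))
                 (fun t => complex.Re (h t) * complex.Im (k t) +
                             complex.Im (h t) * complex.Re (k t))) => [t|t| |].
- exact: cReM.
- exact: cImM.
- apply: (is_derive_eq (is_deriveB (is_deriveM hr kr) (is_deriveM hi ki))).
  by rewrite cReD !cReM /GRing.scale/=; ring.
- apply: (is_derive_eq (is_deriveD (is_deriveM hr ki) (is_deriveM hi kr))).
  by rewrite cImD !cImM /GRing.scale/=; ring.
Qed.

(** The quotient rule is checked on components: with [h = a + ib],
    [1/h = (a - ib) / (a^2 + b^2)]. *)
Lemma cderivV h x d : h x != 0 -> cderiv h x d ->
  cderiv (fun t => (h t)^-1) x (- d * (h x)^-1 ^+ 2).
Proof.
move=> h0 [hr hi].
have n0 := sqr_Re_Im_neq0 h0.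
have dV : is_derive x (1 : R) (fun t => (complex.Re (h t) * complex.Re (h t) +
    complex.Im (h t) * complex.Im (h t))^-1)
  (- (complex.Re (h x) * complex.Re (h x) + complex.Im (h x) * complex.Im (h x)) ^- 2 *:
    (2 * complex.Re (h x) * complex.Re d + 2 * complex.Im (h x) * complex.Im d)).
  apply: is_deriveV => //.
  apply: (is_derive_eq (is_deriveD (is_deriveM hr hr) (is_deriveM hi hi))).
  by rewrite /GRing.scale/=; ring.
pose n t := complex.Re (h t) * complex.Re (h t) + complex.Im (h t) * complex.Im (h t).
apply: (@cderivP (fun t => complex.Re (h t) * (n t)^-1)
                 (fun t => - complex.Im (h t) * (n t)^-1)) => [t|t| |].
- exact: cReV.
- exact: cImV.
- apply: (is_derive_eq (is_deriveM hr dV)).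
  rewrite cReM expr2 cReM cImM cReV cImV /GRing.scale/=; case: d hr hi dV => ? ? * /=.
  by field.
- apply: (is_derive_eq (is_deriveM (is_deriveN hi) dV)).
  rewrite ?fctE cImM expr2 cReM cImM cReV cImV /GRing.scale/=; case: d hr hi dV => ? ? * /=.
  by field.
Qed.

End ComplexCalculus.

Section ComplexIntegral.
Context {R : realType}.
Implicit Types (a b : R) (h k : R -> R[i]).
Local Notation mu := (@lebesgue_measure R).

Lemma complexP (x y : R[i]) : complex.Re x = complex.Re y ->
  complex.Im x = complex.Im y -> x = y.
Proof. by case: x y => ? ? [? ?] /= -> ->. Qed.

Lemma cReB (x y : R[i]) : complex.Re (x - y) = complex.Re x - complex.Re y.
Proof. by case: x y => ? ? []. Qed.
Lemma cImB (x y : R[i]) : complex.Im (x - y) = complex.Im x - complex.Im y.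
Proof. by case: x y => ? ? []. Qed.

Lemma cintD a b h k : ccont a b h -> ccont a b k ->
  cint a b (fun t => h t + k t) = cint a b h + cint a b k.
Proof.
move=> [hr hi] [kr ki]; apply: complexP.
- rewrite cReD /= -RintegralD//; [|exact: continuous_itv_integrable..].
  by apply: eq_Rintegral => t _; rewrite cReD.
- rewrite cImD /= -RintegralD//; [|exact: continuous_itv_integrable..].
  by apply: eq_Rintegral => t _; rewrite cImD.
Qed.

Lemma cintZ a b (z : R[i]) h : ccont a b h ->
  cint a b (fun t => z * h t) = z * cint a b h.
Proof.
move=> [hr hi]; have ir := continuous_itv_integrable hr.
have ii := continuous_itv_integrable hi.
have cZ (c : R) (f : R -> R) : {within `[a, b], continuous f} ->
    mu.-integrable `[a, b] (EFin \o (fun t => c * f t)).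
  move=> cf; apply: continuous_itv_integrable => x; apply: cvgM; last exact: cf.
  exact: cvg_cst.
apply: complexP.
- rewrite cReM /= -!RintegralZl// -RintegralB//; [|exact: cZ..].
  by apply: eq_Rintegral => t _; rewrite cReM.
- rewrite cImM /= -!RintegralZl// -RintegralD//; [|exact: cZ..].
  by apply: eq_Rintegral => t _; rewrite cImM.
Qed.

Lemma Rintegral_bound a b (f : R -> R) (M : R) : a <= b ->
  {within `[a, b], continuous f} -> {in `[a, b], forall t, `|f t| <= M} ->
  `|\int[mu]_(t in `[a, b]) f t| <= M * (b - a).
Proof.
move=> ab cf fM; have if_ := continuous_itv_integrable cf.
apply: le_trans (le_normr_Rintegral _ if_) _ => //.
have -> : M * (b - a) = \int[mu]_(t in `[a, b]) M.
  rewrite Rintegral_cst//= lebesgue_measure_itv/= lte_fin.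
  by case: ltgtP ab => // -[->] _; rewrite subrr.
apply: le_Rintegral => //.
- exact: (integrable_norm if_).
- by apply: continuous_itv_integrable => x; exact: cvg_cst.
Qed.

Lemma Rintegral_FTC a b (F f : R -> R) : a < b ->
  {within `[a, b], continuous F} -> {within `[a, b], continuous f} ->
  {in `]a, b[, forall x, is_derive x (1 : R) F (f x)} ->
  \int[mu]_(t in `[a, b]) f t = F b - F a.
Proof.
move=> ab cF cf dF.
have [cFoo cFa cFb] := (continuous_within_itvP _ ab).1 cF.
rewrite /Rintegral (@continuous_FTC2 _ f F)//.
- by split=> // x xab; have [] := dF x xab.
- by move=> x xab; rewrite derive1E; have [] := dF x xab.
Qed.

Lemma cint_FTC a b F f : a < b -> ccont a b F -> ccont a b f ->
  {in `]a, b[, forall x, cderiv F x (f x)} -> cint a b f = F b - F a.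
Proof.
move=> ab [Fr Fi] [fr fi] dF; apply: complexP.
- rewrite cReB /= (Rintegral_FTC ab Fr fr)// => x xab.
  by have [] := dF x xab.
- rewrite cImB /= (Rintegral_FTC ab Fi fi)// => x xab.
  by have [] := dF x xab.
Qed.

Lemma normc_nneg (x : R[i]) : 0 <= normc x.
Proof. by case: x => x y; exact: sqrtr_ge0. Qed.

Lemma normr_Re_le (x : R[i]) : `|complex.Re x| <= normc x.
Proof.
by case: x => x y /=; rewrite -sqrtr_sqr ler_wsqrtr// lerDl sqr_ge0.
Qed.

Lemma normr_Im_le (x : R[i]) : `|complex.Im x| <= normc x.
Proof.
by case: x => x y /=; rewrite -sqrtr_sqr ler_wsqrtr// lerDr sqr_ge0.
Qed.

Lemma normc_le_sum (x : R[i]) : normc x <= `|complex.Re x| + `|complex.Im x|.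
Proof.
case: x => x y /=; rewrite -(ler_pXn2r (n := 2))// ?nnegrE ?sqrtr_ge0 ?addr_ge0//.
rewrite sqr_sqrtr ?addr_ge0 ?sqr_ge0// sqrrD !real_normK ?num_real//.
by rewrite -addrA addrCA lerDr mulrn_wge0// mulr_ge0.
Qed.

(** The factor 2 comes from bounding the two components separately. *)
Lemma cint_bound a b h (M : R) : a <= b -> ccont a b h ->
  {in `[a, b], forall t, normc (h t) <= M} ->
  normc (cint a b h) <= M * (b - a) *+ 2.
Proof.
move=> ab [hr hi] hM; apply: le_trans (normc_le_sum _) _.
rewrite mulr2n; apply: lerD; apply: Rintegral_bound => // t tab.
- exact: le_trans (normr_Re_le _) (hM t tab).
- exact: le_trans (normr_Im_le _) (hM t tab).
Qed.

Lemma ccont_bounded a b h : a <= b -> ccont a b h ->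
  exists2 M : R, 0 <= M & {in `[a, b], forall t, normc (h t) <= M}.
Proof.
move=> ab [hr hi].
have bd (f : R -> R) : {within `[a, b], continuous f} ->
    exists2 M : R, 0 <= M & {in `[a, b], forall t, `|f t| <= M}.
  move=> cf; have [|c _ cM] := @EVT_max _ (fun t => `|f t|) a b ab.
    by move=> x; apply: cvg_norm; exact: cf.
  by exists `|f c|.
have [M M0 hM] := bd _ hr; have [N N0 hN] := bd _ hi.
exists (M + N); first exact: addr_ge0.
by move=> t tab; apply: le_trans (normc_le_sum _) _; apply: lerD; [exact: hM|exact: hN].
Qed.

End ComplexIntegral.

(** * Contour integrals of continuous functions *)

Section ContourIntegral.
Context {R : realType}.
Variable G : closed_contour R.
Local Notation lo := (contour_lo G).
Local Notation hi := (contour_hi G).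

(** A subdivision of the contour into arcs, arc [i] having the continuous velocity
    [g i] up to its endpoints. *)
Definition contour_pieces (N : nat) (t : nat -> R) (g : nat -> R -> R[i]) :=
  [/\ t 0%N = lo, t N = hi, forall i, (i < N)%N -> t i < t i.+1 &
      forall i, (i < N)%N -> [/\ ccont (t i) (t i.+1) G, ccont (t i) (t i.+1) (g i) &
        {in `]t i, t i.+1[, forall x, cderiv G x (g i x)}]].

Lemma exists_contour_pieces : exists N t g, contour_pieces N t g.
Proof.
have [N [t [t0 tN tC]]] := contour_piecewise_C1 G.
have /choice[g gP] : forall i, exists gi : R -> R[i], (i < N)%N ->
    [/\ ccont (t i) (t i.+1) G, ccont (t i) (t i.+1) gi &
      {in `]t i, t i.+1[, forall x, cderiv G x (gi x)}].
  move=> i; case: (ltnP i N) => [iN|_]; last by exists (fun=> 0).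
  have [_ [Gr [r cr dr]] [Gi [s cs ds]]] := tC i iN.
  exists (fun x => Complex (r x) (s x)) => _; split => // x xt.
  by split; [exact: dr|exact: ds].
by exists N, t, g; split => // i iN; have [] := tC i iN.
Qed.

Definition contour_cont (f : R[i] -> R[i]) := ccont lo hi (fun t => f (G t)).

Lemma pieces_le N t g : contour_pieces N t g ->
  forall i, (i <= N)%N -> lo <= t i /\ t i <= hi.
Proof.
move=> [<- <- tlt _] i iN; split.
  elim: i iN => // i IH iN; apply: le_trans (IH (ltnW iN)) _; exact: ltW (tlt i iN).
rewrite -(subKn iN); elim: (N - i)%N (leq_subr i N) => [|j IH] jN; first by rewrite subn0.
apply: le_trans (IH (ltnW jN)).
have /tlt/ltW : (N - j.+1 < N)%N by rewrite ltn_subrL (leq_trans _ jN).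
by rewrite subnSK.
Qed.

Lemma ccont_contour : ccont lo hi G.
Proof.
have [N [t [g [t0 tN tlt tP]]]] := exists_contour_pieces.
rewrite -t0 -tN.
elim: N tlt tP {tN} => [|N IH] tlt tP.
  rewrite /ccont set_itv1.
  by split; exact: continuous_subspace1.
have [IHr IHi] := IH (fun i iN => tlt i (ltnW iN)) (fun i iN => tP i (ltnW iN)).
have [[Gr Gi] _ _] := tP N (ltnSn _).
have t0N : t 0%N <= t N.
  elim: N tlt {IH IHr IHi tP Gr Gi} => // N IH tlt.
  by apply: le_trans (IH _) (ltW (tlt N _)) => // i iN; apply: tlt; exact: ltnW.
have E : `[t 0%N, t N.+1]%classic =
    `[t 0%N, t N]%classic `|` `[t N, t N.+1]%classic :> set R.
  apply/seteqP; split => x /=; rewrite !in_itv/=.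
    move=> /andP[-> ->]; rewrite andbT.
    by case: (leP x (t N)) => [|/ltW ->]; [left|right].
  have := tlt N (ltnSn _) => tN.
  move=> [/andP[-> xt]|/andP[xt ->]]; first by rewrite (le_trans xt (ltW tN)).
  by rewrite (le_trans t0N xt).
by rewrite /ccont E; split; apply: withinU_continuous => //; exact: itv_closed.
Qed.

Lemma pieces_ccont N t g f : contour_pieces N t g -> contour_cont f ->
  forall i, (i < N)%N -> ccont (t i) (t i.+1) (fun x => f (G x) * g i x).
Proof.
move=> P cf i iN; have [_ _ _ /(_ i iN)[_ cg _]] := P; apply: ccontM => //.
have [l1 _] := pieces_le P (ltnW iN); have [_ l2] := pieces_le P iN.
exact: ccontS cf.
Qed.

(** Replacing the pointwise derivative by the continuous velocities of the arcs
    makes the calculus of continuous functions on segments available. *)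
Lemma contour_integral_pieces N t g f : contour_pieces N t g -> contour_cont f ->
  contour_integral G f = \sum_(i < N) cint (t i) (t i.+1) (fun x => f (G x) * g i x).
Proof.
move=> P cf; have [t0 tN tlt tP] := P.
have cfg := pieces_ccont P cf.
have eq_deriv i : (i < N)%N -> {in `]t i, t i.+1[, contour_deriv G =1 g i}.
  move=> iN x xt; have [_ _ /(_ x xt)[dr di]] := tP i iN.
  by rewrite /contour_deriv !derive1E !derive_val; case: (g i x).
pose h x := f (G x) * contour_deriv G x.
have [_ _ er] := @Rintegral_pieces _ (fun x => complex.Re (h x))
  (fun i x => complex.Re (f (G x) * g i x)) t N tlt (fun i iN => (cfg i iN).1)
  (fun i iN x xt => congr1 (fun d => complex.Re (f (G x) * d)) (eq_deriv i iN x xt)).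
have [_ _ ei] := @Rintegral_pieces _ (fun x => complex.Im (h x))
  (fun i x => complex.Im (f (G x) * g i x)) t N tlt (fun i iN => (cfg i iN).2)
  (fun i iN x xt => congr1 (fun d => complex.Im (f (G x) * d)) (eq_deriv i iN x xt)).
rewrite t0 tN in er ei; rewrite /contour_integral er ei.
elim: (N) => [|k IH]; first by rewrite !big_ord0.
by rewrite [RHS]big_ord_recr -IH !big_ord_recr.
Qed.

Lemma contour_integralD f k : contour_cont f -> contour_cont k ->
  contour_integral G (fun z => f z + k z) =
  contour_integral G f + contour_integral G k.
Proof.
have [N [t [g P]]] := exists_contour_pieces => cf ck.
rewrite !(contour_integral_pieces P)//; last exact: ccontD.
rewrite -big_split; apply: eq_bigr => i _ /=.
rewrite -cintD; [|exact: pieces_ccont P _ _ _..].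
by congr cint; apply/funext => x; rewrite mulrDl.
Qed.

Lemma contour_integralZ (c : R[i]) f : contour_cont f ->
  contour_integral G (fun z => c * f z) = c * contour_integral G f.
Proof.
have [N [t [g P]]] := exists_contour_pieces => cf.
rewrite !(contour_integral_pieces P)//; last by apply: ccontM => //; exact: ccont_cst.
rewrite mulr_sumr; apply: eq_bigr => i _ /=.
rewrite -cintZ; last exact: pieces_ccont P _ _ _.
by congr cint; apply/funext => x; rewrite mulrA.
Qed.

Lemma eq_contour_integral f k :
  (forall z, contour_image G z -> f z = k z) ->
  contour_integral G f = contour_integral G k.
Proof.
move=> fk; rewrite /contour_integral; congr Complex.
all: by apply: eq_Rintegral => x; rewrite inE => xI; rewrite fk//; exists x.
Qed.

Lemma contour_integral_bound : exists2 L : R, 0 <= L &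
  forall f (M : R), contour_cont f -> 0 <= M ->
    (forall z, contour_image G z -> normc (f z) <= M) ->
    normc (contour_integral G f) <= L * M.
Proof.
have [N [t [g P]]] := exists_contour_pieces; have [_ _ tlt tP] := P.
have /choice[B BP] : forall i, exists B : R, (i < N)%N ->
    0 <= B /\ {in `[t i, t i.+1], forall x, normc (g i x) <= B}.
  move=> i; case: (ltnP i N) => [iN|_]; last by exists 0.
  have [_ cg _] := tP i iN.
  by have [M M0 MP] := ccont_bounded (ltW (tlt i iN)) cg; exists M.
exists (\sum_(i < N) B i * (t i.+1 - t i) *+ 2).
  apply: sumr_ge0 => i _; rewrite mulrn_wge0// mulr_ge0 ?(BP i _).1//.
  by rewrite subr_ge0 ltW// tlt.
move=> f M cf M0 fM; rewrite (contour_integral_pieces P cf) mulr_suml.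
elim/big_ind2 : _ => [|x1 x2 y1 y2 h1 h2|i _]; first by rewrite normc0.
  exact: le_trans (le_normcD _ _) (lerD h1 h2).
have [B0 gB] := BP i (ltn_ord i).
have [l1 _] := pieces_le P (ltnW (ltn_ord i)); have [_ l2] := pieces_le P (ltn_ord i).
rewrite mulrnAl mulrAC; apply: cint_bound; first exact/ltW/tlt.
  exact: pieces_ccont P _ _ _.
move=> x xt; rewrite normcM mulrC ler_pM ?normc_nneg//; first exact: gB.
apply: fM; exists x => //; move: xt; rewrite /= !in_itv/= => /andP[tx xt].
by rewrite (le_trans l1 tx) (le_trans xt l2).
Qed.

(** An integrand with a primitive along the contour integrates to 0: the integrals
    over the arcs telescope and the contour is closed. *)
Lemma contour_integral_exact F f : contour_cont F -> contour_cont f ->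
  (forall x d, x \in `[lo, hi] -> cderiv G x d ->
     cderiv (fun y => F (G y)) x (f (G x) * d)) ->
  contour_integral G f = 0.
Proof.
have [N [t [g P]]] := exists_contour_pieces; have [t0 tN tlt tP] := P.
move=> cF cf dF; rewrite (contour_integral_pieces P cf).
under eq_bigr => i _.
  have [l1 _] := pieces_le P (ltnW (ltn_ord i)).
  have [_ l2] := pieces_le P (ltn_ord i).
  rewrite (@cint_FTC _ _ _ (fun x => F (G x))); first over.
  - exact: tlt.
  - exact: ccontS cF.
  - exact: pieces_ccont P _ _ _.
  - move=> x xt; apply: dF.
      move: xt; rewrite !in_itv/= => /andP[tx xt].
      by rewrite (le_trans l1 (ltW tx)) (le_trans (ltW xt) l2).
    by have [_ _] := tP i (ltn_ord i); apply.
rewrite -(big_mkord xpredT (fun i => F (G (t i.+1)) - F (G (t i)))) telescope_sumr//.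
by rewrite t0 tN contour_closed subrr.
Qed.

End ContourIntegral.

(** * Winding integrals *)

Section WindingIntegral.
Context {R : realType}.
Variable G : closed_contour R.
Local Notation lo := (contour_lo G).
Local Notation hi := (contour_hi G).
Local Notation ccontG := (contour_cont G).
Implicit Types (f k : R[i] -> R[i]) (mu : R[i]) (p q : {poly R[i]}).

Lemma contour_cont_cst (c : R[i]) : ccontG (fun=> c).
Proof. exact: ccont_cst. Qed.

Lemma contour_cont_id : ccontG id.
Proof. exact: ccont_contour. Qed.

Lemma contour_contD f k : ccontG f -> ccontG k -> ccontG (fun z => f z + k z).
Proof. exact: ccontD. Qed.

Lemma contour_contM f k : ccontG f -> ccontG k -> ccontG (fun z => f z * k z).
Proof. exact: ccontM. Qed.

Lemma contour_contV f : (forall z, contour_image G z -> f z != 0) ->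
  ccontG f -> ccontG (fun z => (f z)^-1).
Proof. by move=> f0; apply: ccontV => x xI; apply: f0; exists x. Qed.

Lemma contour_contX f n : ccontG f -> ccontG (fun z => f z ^+ n).
Proof.
move=> cf; elim: n => [|n IH].
  by under [X in contour_cont _ X]funext do rewrite expr0; exact: contour_cont_cst.
by under [X in contour_cont _ X]funext do rewrite exprS; exact: contour_contM.
Qed.

Lemma contour_cont_horner p f : ccontG f -> ccontG (fun z => p.[f z]).
Proof.
move=> cf; elim/poly_ind: p => [|p c IH].
  by under [X in contour_cont _ X]funext do rewrite horner0; exact: contour_cont_cst.
under [X in contour_cont _ X]funext do rewrite hornerMXaddC.
by apply: contour_contD; [exact: contour_contM|exact: contour_cont_cst].
Qed.

Lemma contour_contVsub mu : ~ contour_image G mu ->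
  ccontG (fun z => (z - mu)^-1).
Proof.
move=> nmu; apply: contour_contV.
  by move=> z zG; rewrite subr_eq0; apply/eqP => zmu; rewrite -zmu in nmu.
by apply: contour_contD; [exact: contour_cont_id|exact: contour_cont_cst].
Qed.

Lemma cderiv_horner p (h : R -> R[i]) x d : cderiv h x d ->
  cderiv (fun t => p.[h t]) x (p^`().[h x] * d).
Proof.
move=> dh; elim/poly_ind: p => [|p c IH].
  rewrite linear0 horner0 mul0r; under [X in cderiv X]funext do rewrite horner0.
  exact: cderiv_cst.
under [X in cderiv X]funext do rewrite hornerMXaddC.
have := cderivD (cderivM IH dh) (cderiv_cst c x).
by rewrite derivD derivM derivX derivC addr0 mulr1 addr0 hornerD hornerM hornerX mulrDl mulrAC.
Qed.

Lemma poly_primitive q : exists p, p^`() = q.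
Proof.
exists (\poly_(i < (size q).+1) (q`_i.-1 / i%:R)); apply/polyP => i.
rewrite coef_deriv coef_poly ltnS; case: ltnP => [_|qi]; last by rewrite mul0rn nth_default.
by rewrite -[LHS]mulr_natr divfK// pnatr_eq0.
Qed.

Lemma contour_integral_poly q : contour_integral G (fun z => q.[z]) = 0.
Proof.
have [p <-] := poly_primitive q.
apply: (@contour_integral_exact _ _ (fun z => p.[z])) => [||x d _ dG].
- exact/contour_cont_horner/contour_cont_id.
- exact/contour_cont_horner/contour_cont_id.
- exact: cderiv_horner.
Qed.

(** With [w = 1/(z - mu)] one has [dw = - w^2 dz], so [q(w) w^2 dz] is exact for
    every polynomial [q]. This covers all poles of order at least 2. *)
Lemma contour_integral_poly_inv mu q : ~ contour_image G mu ->
  contour_integral G (fun z => q.[(z - mu)^-1] * (z - mu)^-1 ^+ 2) = 0.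
Proof.
move=> nmu; have cV := contour_contVsub nmu.
have [p pq] := poly_primitive (- q).
apply: (@contour_integral_exact _ _ (fun z => p.[(z - mu)^-1])) => [||x d xI dG].
- exact/contour_cont_horner.
- by apply: contour_contM; [exact/contour_cont_horner|exact/contour_contX].
- have -> : q.[(G x - mu)^-1] * (G x - mu)^-1 ^+ 2 * d =
      p^`().[(G x - mu)^-1] * (- (d + 0) * (G x - mu)^-1 ^+ 2).
    by rewrite pq hornerN addr0; ring.
  apply: (@cderiv_horner _ (fun y => (G y - mu)^-1)).
  apply: (@cderivV _ (fun y => G y - mu)); last exact: cderivD dG (cderiv_cst _ _).
  by rewrite subr_eq0; apply/eqP => Gx; apply: nmu; exists x.
Qed.

Lemma contour_bounded f : ccontG f ->
  exists2 M : R, 0 <= M & forall z, contour_image G z -> normc (f z) <= M.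
Proof.
move=> cf; have [M M0 fM] := ccont_bounded (ltW (contour_lt G)) cf.
by exists M => // z [t tI <-]; exact: fM.
Qed.

Lemma geometric_bound_eq0 (x K : R) :
  0 <= x -> (forall n, x <= K * 2^-1 ^+ n) -> x = 0.
Proof.
move=> x0 xK; apply/eqP; rewrite eq_le x0 andbT.
have half1 : `|(2^-1 : R)| < 1 by rewrite ger0_norm ?invf_lt1 ?ltr1n ?invr_ge0.
apply: (cvgr_to_ge (cvg_geometric K half1)).
by near=> n; exact: xK.
Unshelve. all: by end_near.
Qed.

(** If multiplying the integrand by a ratio [rho], of modulus at most 1/2 on the
    contour, never changes the integral of [rho^n f], then the integral equals
    one bounded by [L M 2^-n] for every [n]. It plays the part of summing a
    geometric series under the integral sign. *)
Lemma contour_integral_geometric (rho f : R[i] -> R[i]) :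
  ccontG rho -> ccontG f ->
  (forall z, contour_image G z -> normc (rho z) <= 2^-1) ->
  (forall n, contour_integral G (fun z => rho z ^+ n.+1 * f z) =
             contour_integral G (fun z => rho z ^+ n * f z)) ->
  contour_integral G f = 0.
Proof.
move=> crho cf rho_half eqI; have [L L0 LP] := contour_integral_bound G.
have [M M0 MP] := contour_bounded cf.
have eqI0 n : contour_integral G f = contour_integral G (fun z => rho z ^+ n * f z).
  elim: n => [|n IH]; last by rewrite eqI.
  by congr contour_integral; apply/funext => z; rewrite expr0 mul1r.
apply: eq0_normc; apply: (@geometric_bound_eq0 _ (L * M)) => [|n]; first exact: normc_nneg.
have half0 : 0 <= (2^-1 : R) ^+ n by rewrite exprn_ge0 ?invr_ge0.
rewrite (eqI0 n) -mulrA; apply: LP; last 1 first.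
- move=> z zG; rewrite normcM mulrC ler_pM ?normc_nneg ?MP//.
  elim: n {half0} => [|n IH]; first by rewrite !expr0 normc1.
  by rewrite !exprS normcM ler_pM ?normc_nneg ?rho_half.
- by apply: contour_contM => //; exact: contour_contX.
- exact: mulr_ge0.
Qed.

(** This is 2 pi i times the winding number of the contour around [mu]. *)
Definition winding_integral mu := contour_integral G (fun z => (z - mu)^-1).

(** The contour is compact, so a point off it lies at positive distance. *)
Lemma contour_dist mu : ~ contour_image G mu ->
  exists2 e : R, 0 < e & forall z, contour_image G z -> e <= normc (z - mu).
Proof.
move=> nmu.
have [rc ic] : ccontG (fun z => z - mu).
  by apply: contour_contD; [exact: contour_cont_id|exact: contour_cont_cst].
have [|c cI cmin] := @EVT_min _ (fun t => complex.Re (G t - mu) * complex.Re (G t - mu) +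
    complex.Im (G t - mu) * complex.Im (G t - mu)) _ _ (ltW (contour_lt G)).
  by move=> x; apply: cvgD; apply: cvgM; [exact: rc|exact: rc|exact: ic|exact: ic].
have normcE' (z : R[i]) : normc z =
    Num.sqrt (complex.Re z * complex.Re z + complex.Im z * complex.Im z).
  by case: z => x y; rewrite /= -!expr2.
exists (normc (G c - mu)).
  rewrite lt_neqAle normc_nneg andbT eq_sym; apply/eqP => /eq0_normc/subr0_eq Gc.
  by apply: nmu; exists c.
by move=> _ [t tI <-]; rewrite !normcE'; apply: ler_wsqrtr; exact: cmin.
Qed.

(** Iterating [1/(z - mu - h) = 1/(z - mu) + h/(z - mu) * 1/(z - mu - h)] expands
    the integrand at [mu + h] in powers of [1/(z - mu)]. All powers beyond the
    first integrate to 0, and the remainder decays geometrically as soon as [h]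
    is at most half the distance from [mu] to the contour. *)
Lemma winding_integral_locally_cst mu : ~ contour_image G mu ->
  exists2 e : R, 0 < e & forall h, normc h < e ->
    ~ contour_image G (mu + h) /\ winding_integral (mu + h) = winding_integral mu.
Proof.
move=> nmu; have [e e0 eP] := contour_dist nmu.
exists (e / 2); first by rewrite divr_gt0.
move=> h hlt.
have nmuh : ~ contour_image G (mu + h).
  move=> /eP; rewrite addrC addKr leNgt => /negP; apply.
  by apply: lt_trans hlt _; rewrite ltr_pdivrMr// ltr_pMr// ltr1n.
split => //.
pose rho z := h * (z - mu)^-1.
pose v z := (z - (mu + h))^-1.
have cw : ccontG (fun z => (z - mu)^-1) := contour_contVsub nmu.
have cv : ccontG v := contour_contVsub nmuh.
have crho : ccontG rho by apply: contour_contM => //; exact: contour_cont_cst.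
have crv n : ccontG (fun z => rho z ^+ n * v z).
  by apply: contour_contM => //; exact: contour_contX.
have vE z : contour_image G z -> v z = (z - mu)^-1 + rho z * v z.
  move=> zG; rewrite /rho /v.
  have n1 : z - mu != 0 by rewrite subr_eq0; apply/eqP => E; apply: nmu; rewrite -E.
  have n2 : z - (mu + h) != 0 by rewrite subr_eq0; apply/eqP => E; apply: nmuh; rewrite -E.
  have -> : h = (z - mu) - (z - (mu + h)) by ring.
  by rewrite [X in _ + _ * X^-1](_ : _ = z - (mu + h)); [field; rewrite n1 n2|ring].
have -> : winding_integral (mu + h) =
    winding_integral mu + contour_integral G (fun z => rho z * v z).
  rewrite -contour_integralD//; last exact: contour_contM.
  by apply: eq_contour_integral => z zG; exact: vE.
rewrite [X in _ + X](_ : _ = 0) ?addr0//.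
apply: (contour_integral_geometric crho); first exact: contour_contM.
  move=> z zG; rewrite /rho normcM normcV ler_pdivrMr; last first.
    by apply: lt_le_trans e0 _; exact: eP.
  apply: le_trans (ltW hlt) _; rewrite mulrC ler_wpM2l ?invr_ge0//; exact: eP.
move=> n.
have -> : contour_integral G (fun z => rho z ^+ n * (rho z * v z)) =
    contour_integral G (fun z => (h ^+ n.+1 *: 'X^n).[(z - mu)^-1] * (z - mu)^-1 ^+ 2 +
      rho z ^+ n.+1 * (rho z * v z)).
  apply: eq_contour_integral => z zG; rewrite [in LHS]vE// hornerZ hornerXn /rho.
  by rewrite !exprMn !exprS expr0; ring.
rewrite contour_integralD.
- by rewrite contour_integral_poly_inv// add0r.
- by apply: contour_contM; [exact/contour_cont_horner|exact/contour_contX].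
- by apply: contour_contM; [exact/contour_contX|exact: contour_contM].
Qed.

(** Far away, [1/(z - mu)] expands in powers of [z/mu], which all integrate to 0. *)
Lemma winding_integral_far : exists2 M : R, 0 <= M &
  forall mu, M < normc mu -> ~ contour_image G mu -> winding_integral mu = 0.
Proof.
have [M M0 MP] := contour_bounded contour_cont_id.
exists (M * 2); first by rewrite mulr_ge0.
move=> mu muM nmu.
have mu_gt0 : 0 < normc mu by apply: le_lt_trans muM; rewrite mulr_ge0.
have mu0 : mu != 0 by apply/eqP => E; move: mu_gt0; rewrite E normc0 ltxx.
pose rho z := z * mu^-1.
have crho : ccontG rho by apply: contour_contM; [exact: contour_cont_id|exact: contour_cont_cst].
have cw := contour_contVsub nmu.
apply: (contour_integral_geometric crho) => //.
  move=> z /MP zM; rewrite /rho normcM normcV ler_pdivrMr//.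
  by rewrite ler_pdivlMl// mulrC; apply: le_trans (ltW muM); rewrite ler_wpM2r.
move=> n; apply/esym.
have -> : contour_integral G (fun z => rho z ^+ n * (z - mu)^-1) =
    contour_integral G (fun z => (- (mu^-1 ^+ n.+1) *: 'X^n).[z] +
      rho z ^+ n.+1 * (z - mu)^-1).
  apply: eq_contour_integral => z zG; rewrite hornerZ hornerXn /rho.
  have n1 : z - mu != 0 by rewrite subr_eq0; apply/eqP => E; apply: nmu; rewrite -E.
  rewrite !exprMn !exprS.
  by move: (z ^+ n) (mu^-1 ^+ n) => a b; field; rewrite mu0 n1.
rewrite contour_integralD.
- by rewrite contour_integral_poly add0r.
- exact/contour_cont_horner/contour_cont_id.
- by apply: contour_contM => //; exact/contour_contX.
Qed.

Lemma normC_normc (z : R[i]) : `|z| = (normc z)%:C%C.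
Proof. by rewrite normc_def; case: z. Qed.

Lemma open_winding (P : R[i] -> Prop) :
  open ([set z | ~ contour_image G z /\ P (winding_integral z)] : set R[i]^o).
Proof.
rewrite openE => mu [nmu Pmu].
have [e e0 eP] := winding_integral_locally_cst nmu.
apply/nbhs_ballP; exists e%:C%C; first by rewrite /= ltcR.
move=> z; rewrite -ball_normE /= normC_normc ltcR => zmu.
have [] := eP (z - mu); first by rewrite -normcN opprB.
by rewrite addrC subrK => ? ->.
Qed.

(** A point off the contour and outside its interior lies in an unbounded component
    of the complement. On that component the winding integral is locally
    constant, and it vanishes at a far enough point. *)
Lemma winding_integral_exterior mu : ~ contour_image G mu -> ~ contour_interior G mu ->
  winding_integral mu = 0.
Proof.
move=> nmu nint; have [M M0 MP] := winding_integral_far.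
have : ~ bounded_set (connected_component (~` contour_image G) mu).
  by move=> b; apply: nint.
move=> /(contra_notP); apply => Wmu.
exists M%:C%C; split; first by apply/complex_realP; exists M.
move=> x Mx z [B [Bmu BG Bconn] Bz] /=; rewrite normC_normc.
suff : normc z <= M by rewrite -lecR => zM; exact: le_trans zM (ltW Mx).
rewrite leNgt; apply/negP => zM.
have Wz := MP z zM (BG z Bz).
have BE : B `&` [set z | ~ contour_image G z /\ winding_integral z = 0] = B.
  apply: Bconn; first by exists z; split => //; split => //; exact: BG.
    exists [set z | ~ contour_image G z /\ winding_integral z = 0] => //.
    exact: (@open_winding (fun w => w = 0)).
  exists (~` [set z | ~ contour_image G z /\ winding_integral z <> 0]).
    exact/open_closedC/(@open_winding (fun w => w <> 0)).
  apply/seteqP; split => y [By]; first by move=> [_ yW]; split => // -[].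
  by move=> yW; split => //; split; [exact: BG|apply: contrapT => W0; apply: yW; split => //; exact: BG].
by move: Bmu; rewrite -BE => -[_ [_ /Wmu]].
Qed.

End WindingIntegral.

(** * Rational integrands with exterior poles *)

Section RationalIntegrals.
Context {R : realType}.
Variable G : closed_contour R.
Local Notation ccontG := (contour_cont G).
Implicit Types (p q : {poly R[i]}) (rs : seq R[i]).

Definition root_poly rs : {poly R[i]} := \prod_(r <- rs) ('X - r%:P).

Lemma root_poly_cons r rs z :
  (root_poly (r :: rs)).[z] = (z - r) * (root_poly rs).[z].
Proof. by rewrite /root_poly big_cons hornerM hornerXsubC. Qed.

Lemma root_poly_neq0 rs z : {in rs, forall r, ~ contour_image G r} ->
  contour_image G z -> (root_poly rs).[z] != 0.
Proof.
move=> off zG; rewrite -rootE root_prod_XsubC; apply/negP => /off; exact.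
Qed.

Lemma contour_cont_ratio p q : (forall z, contour_image G z -> q.[z] != 0) ->
  ccontG (fun z => p.[z] / q.[z]).
Proof.
move=> q0; apply: contour_contM; first exact/contour_cont_horner/contour_cont_id.
by apply: contour_contV => //; exact/contour_cont_horner/contour_cont_id.
Qed.

(** Cauchy's theorem for a rational integrand with all poles in the exterior.
    Euclidean division by one factor [z - a] reduces to a constant numerator.
    If all roots equal [a], either the winding integral vanishes (simple pole) or
    the integrand is exact; if some root [b] differs from [a], the identity
    [1/((z-a)(z-b)) = (1/(z-a) - 1/(z-b)) / (a-b)] removes one factor. *)
Lemma contour_integral_exterior_poles p rs :
  {in rs, forall r, ~ contour_image G r /\ winding_integral G r = 0} ->
  contour_integral G (fun z => p.[z] / (root_poly rs).[z]) = 0.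
Proof.
have [n] := ubnP (size rs); elim: n p rs => // n IH p [|a s] /= ssn ext.
  rewrite -(contour_integral_poly G p); congr contour_integral; apply/funext => z.
  by rewrite /root_poly big_nil hornerC divr1.
have off (t : seq R[i]) : {subset t <= a :: s} -> {in t, forall r, ~ contour_image G r}.
  by move=> ts r /ts /ext[].
have cR q t : {subset t <= a :: s} -> ccontG (fun z => q.[z] / (root_poly t).[z]).
  by move=> ts; apply: contour_cont_ratio => z; apply: root_poly_neq0; exact: off.
have sub_s : {subset s <= a :: s} by move=> r rs; rewrite in_cons rs orbT.
have [aG aW] := ext a (mem_head _ _).
have a_neq z : contour_image G z -> z - a != 0.
  by move=> zG; rewrite subr_eq0; apply/eqP => E; apply: aG; rewrite -E.
have -> : contour_integral G (fun z => p.[z] / (root_poly (a :: s)).[z]) =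
    contour_integral G (fun z => (p %/ ('X - a%:P)).[z] / (root_poly s).[z] +
      p.[a] * ((1 : {poly R[i]}).[z] / (root_poly (a :: s)).[z])).
  apply: eq_contour_integral => z zG.
  have s0 := root_poly_neq0 (off _ sub_s) zG.
  rewrite {1}(divp_eq p ('X - a%:P)) modp_XsubC hornerD hornerM hornerXsubC !hornerC.
  rewrite root_poly_cons; field; rewrite s0 /=; exact: a_neq.
rewrite contour_integralD;
  [|exact: cR|by apply: contour_contM; [exact: contour_cont_cst|exact: cR]].
rewrite IH ?add0r//; last by move=> r /sub_s; exact: ext.
rewrite contour_integralZ; last exact: cR.
rewrite [X in _ * X](_ : _ = 0) ?mulr0//.
have [/all_pred1P sE|/allPn[b bs ba]] := boolP (all (pred1 a) s).
  rewrite sE; case: (size s) => [|k].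
    rewrite -[RHS]aW; congr contour_integral; apply/funext => z.
    by rewrite root_poly_cons /root_poly big_nil !hornerC mulr1 mul1r.
  rewrite -[RHS](contour_integral_poly_inv 'X^k aG); congr contour_integral.
  apply/funext => z; rewrite (_ : a :: _ = nseq k.+2 a)//.
  have -> j : (root_poly (nseq j a)).[z] = (z - a) ^+ j.
    elim: j => [|j IHj]; first by rewrite /root_poly big_nil hornerC.
    by rewrite root_poly_cons IHj exprS.
  by rewrite hornerXn hornerC mul1r -exprVn -exprD addn2.
have bE : perm_eq s (b :: rem b s) := perm_to_rem bs.
have sub_rem c : c \in a :: s -> {subset c :: rem b s <= a :: s}.
  by move=> cs r /predU1P[->//|/mem_rem/sub_s].
have bas : b \in a :: s by exact: sub_s.
have sz c : (size (c :: rem b s) < n)%N.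
  by have /perm_size/= sE := bE; rewrite /= -sE.
have ab : a - b != 0 by rewrite subr_eq0 eq_sym.
have -> : contour_integral G (fun z => (1 : {poly R[i]}).[z] / (root_poly (a :: s)).[z]) =
    contour_integral G (fun z => ((a - b)^-1)%:P.[z] / (root_poly (a :: rem b s)).[z] +
      (- (a - b)^-1)%:P.[z] / (root_poly (b :: rem b s)).[z]).
  apply: eq_contour_integral => z zG; rewrite !hornerC.
  rewrite root_poly_cons [root_poly s](perm_big _ bE) -/(root_poly _) !root_poly_cons.
  have r0 : (root_poly (rem b s)).[z] != 0.
    by apply: root_poly_neq0 zG; apply: off => r /mem_rem/sub_s.
  have b0 : z - b != 0.
    by rewrite subr_eq0; apply/eqP => E; have [bG _] := ext b bas; apply: bG; rewrite -E.
  by field; rewrite r0 b0 ab a_neq.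
rewrite contour_integralD; [|by apply: cR; apply: sub_rem; rewrite ?mem_head..].
by rewrite !IH ?addr0// => r /sub_rem; [move/(_ bas)|move/(_ (mem_head _ _))]; exact: ext.
Qed.

End RationalIntegrals.

(** * Linear recurrences, companion matrices and Hankel matrices *)

Lemma char_poly_trmx (F : comNzRingType) (n : nat) (M : 'M[F]_n) :
  char_poly M^T = char_poly M.
Proof.
rewrite /char_poly -[RHS]det_tr; congr (\det _).
by apply/matrixP => i j; rewrite !mxE eq_sym.
Qed.

Section HankelCompanion.
Variable F : comNzRingType.

(** Right multiplication by the transposed companion matrix shifts a window of a
    sequence satisfying the linear recurrence with characteristic polynomial [p]:
    its last column applies the recurrence, the others merely select. *)
Lemma mulmx_companionT (p : {poly F}) (n : nat) (s : nat -> 'cV[F]_n) :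
  p \is monic -> (forall k, \sum_(j < size p) p`_j *: s (j + k)%N = 0) ->
  forall k, (\matrix_(i < n, j < (size p).-1) s (j + k)%N i ord0) *m (companionmx p)^T =
            \matrix_(i < n, j < (size p).-1) s (j + k.+1)%N i ord0.
Proof.
move=> p_monic rec k; apply/matrixP => i j; rewrite !mxE.
under eq_bigr do rewrite !mxE.
have sp : (size p).-1.+1 = size p.
  by rewrite prednK// lt0n size_poly_eq0 monic_neq0.
have [jlast|jN] := eqVneq (j : nat) (size p).-1.-1; last first.
  have jlt : (j.+1 < (size p).-1)%N.
    rewrite -ltn_predRL ltn_neqAle jN -ltnS prednK ?ltn_ord//.
    exact: leq_ltn_trans (ltn_ord j).
  rewrite (bigD1 (Ordinal jlt))//= eqxx mulr1 addSnnS big1 ?addr0// => t tj.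
  by rewrite -val_eqE/= eq_sym in tj; rewrite (negbTE tj) mulr0.
have jS : (j + k.+1 = (size p).-1 + k)%N.
  by rewrite addnS -addSn jlast prednK// (leq_ltn_trans _ (ltn_ord j)).
have recS : \sum_(j < (size p).-1.+1) p`_j *: s (j + k)%N = 0 by rewrite sp.
have := congr1 (fun v : 'cV_n => v i ord0) recS.
rewrite big_ord_recr/= mxE [X in _ = X]mxE summxE.
have -> : p`_(size p).-1 = 1 by move/monicP: p_monic.
rewrite scale1r jS => /eqP; rewrite addrC addr_eq0 => /eqP ->.
by rewrite -sumrN; apply: eq_bigr => t _; rewrite mxE mulrN mulrC.
Qed.

End HankelCompanion.

Section ShiftPair.
Context {R : realType} {n l : nat}.
Variables (A : 'I_l.+1 -> 'M[R[i]]_n) (D : {poly R[i]}).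
Variables (s : nat -> 'cV[R[i]]_n) (w : 'rV[R[i]]_n).
Hypothesis D_monic : D \is monic.
Local Notation m := (size D).-1.
Local Notation C := (companionmx D)^T.
Hypothesis recD : forall k, \sum_(j < size D) D`_j *: s (j + k)%N = 0.
Hypothesis recA : forall k, \sum_(j < l.+1) A j *m s (j + k)%N = 0.

Definition shift_mx k : 'M[R[i]]_(n, m) := \matrix_(i, j) s (j + k)%N i ord0.

Lemma shift_mxX k : shift_mx 0 *m C ^+ k = shift_mx k.
Proof.
elim: k => [|k IH]; first by rewrite expr0 mulmx1.
by rewrite exprSr mulmxA IH; exact: mulmx_companionT.
Qed.

Lemma mpoly_pair_shift : mpoly_pair A (shift_mx 0) C = 0.
Proof.
rewrite /mpoly_pair; under eq_bigr do rewrite -mulmxA shift_mxX.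
apply/matrixP => i k; rewrite summxE [RHS]mxE.
have := congr1 (fun v : 'cV_n => v i ord0) (recA k); rewrite summxE mxE => sumE.
rewrite -[RHS]sumE; apply: eq_bigr => j _; rewrite !mxE; apply: eq_bigr => t _.
by rewrite mxE addnC.
Qed.

Definition shift_hankel e : 'M[R[i]]_m := \matrix_(i, j) (w *m s (i + j + e)%N) ord0 ord0.

Lemma row_shift_hankel e i : row i (shift_hankel e) = w *m shift_mx (i + e).
Proof.
apply/rowP => j; rewrite !mxE; apply: eq_bigr => t _.
by rewrite mxE addnAC addnC addnA.
Qed.

Lemma shift_hankelS : shift_hankel 1 = shift_hankel 0 *m C.
Proof.
apply/row_matrixP => i; rewrite row_mul !row_shift_hankel addn1 addn0 -mulmxA.
by congr (_ *m _); apply/esym; exact: (mulmx_companionT D_monic recD).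
Qed.

Hypothesis H0_unit : shift_hankel 0 \in unitmx.

(** The left multiples by [w] of the blocks [X, X C, ...] are the rows of the Hankel
    matrix, so the stack has at least the rank of that invertible matrix. *)
Lemma minimal_shift_pair : minimal_pair (shift_mx 0) C.
Proof.
(* The blocks are listed by decreasing exponent, hence the reversed index. *)
exists m; apply/eqP; rewrite eqn_leq rank_leq_col /=.
rewrite -{1}(mxrank_unit H0_unit).
have <- : (\mxrow_(i < m) (delta_mx (rev_ord i) ord0 *m w)) *m
    (\mxcol_(i < m) (shift_mx 0 *m C ^+ (m.-1 - i))) = shift_hankel 0.
  rewrite mul_mxrow_mxcol (reindex_inj rev_ord_inj)/=.
  apply/row_matrixP => i; rewrite row_shift_hankel addn0.
  have d1 : delta_mx (0 : 'I_1) (0 : 'I_1) = 1%:M :> 'M[R[i]]_1.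
    by apply/matrixP => a b; rewrite !ord1 !mxE.
  rewrite raddf_sum (bigD1 i)//= big1 ?addr0 => [|j ji].
    rewrite rev_ordK rowE -!mulmxA mulmxA mul_delta_mx d1 mul1mx shift_mxX.
    by congr (_ *m shift_mx _); rewrite /=; have := ltn_ord i; lia.
  by rewrite rev_ordK rowE -!mulmxA mulmxA mul_delta_mx_0 ?mul0mx// eq_sym.
exact: mxrankM_maxr.
Qed.

End ShiftPair.

(** * Moments of the resolvent *)

Lemma size_det_leq (F : comNzRingType) (n d : nat) (M : 'M[{poly F}]_n) :
  (forall i j, (size (M i j) <= d.+1)%N) -> (size (\det M) <= (n * d).+1)%N.
Proof.
move=> sM; apply: (leq_trans (size_sum _ _ _)); apply/bigmax_leqP => sg _.
rewrite mulr_sign (fun_if (fun p : {poly F} => size p)) size_polyN if_same.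
have size_prod : forall r : seq 'I_n,
    (size (\prod_(i <- r) M i (sg i))%R <= (size r * d).+1)%N.
  elim=> [|i r IH]; first by rewrite big_nil size_poly1.
  rewrite big_cons; apply: leq_trans (size_polyMleq _ _) _.
  have := sM i (sg i); move: IH => /=; set a := size _; set b := size _; lia.
by have := size_prod (enum 'I_n); rewrite big_enum size_enum_ord.
Qed.

Lemma count_codom (T : eqType) (I : finType) (f : I -> T) (r : seq T) :
  injective f ->
  count (fun x => x \in codom f) r = (\sum_i count_mem (f i) r)%N.
Proof.
move=> f_inj; elim: r => [|x r IH] /=; first by rewrite big1.
rewrite big_split /= IH; congr addn.
have [/codomP[j ->]|xN] := boolP (x \in codom f).
  rewrite (bigD1 j)//= eqxx big1// => i ij.
  by rewrite (inj_eq f_inj) eq_sym (negbTE ij).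
rewrite big1// => i _; case: eqP => // xE.
by rewrite xE codom_f in xN.
Qed.

Section MatrixPolynomialMoments.
Context {R : realType} {n l : nat}.
Variables (A : 'I_l.+1 -> 'M[R[i]]_n) (G : closed_contour R).
Implicit Types (v : 'cV[R[i]]_n) (p q : {poly R[i]}).
Local Notation d := (\det (mpoly_mx A)).

Lemma mpoly_eval_map z : mpoly_eval A z = map_mx (horner_eval z) (mpoly_mx A).
Proof.
apply/matrixP => i j; rewrite mxE /horner_eval !summxE horner_sum.
by apply: eq_bigr => k _; rewrite !mxE hornerM hornerXn hornerC.
Qed.

Lemma det_mpoly_eval z : \det (mpoly_eval A z) = d.[z].
Proof. by rewrite mpoly_eval_map det_map_mx. Qed.

Lemma size_det_mpoly : (size d <= (l * n).+1)%N.
Proof.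
rewrite mulnC; apply: size_det_leq => i j.
rewrite summxE; apply: (leq_trans (size_sum _ _ _)); apply/bigmax_leqP => k _.
rewrite !mxE mulrC mul_polyC; apply: leq_trans (size_scale_leq _ _) _.
by rewrite size_polyXn ltn_ord.
Qed.

Hypothesis no_eig : forall z, mpoly_eigenvalue A z -> ~ contour_image G z.

Lemma det_neq0_contour z : contour_image G z -> d.[z] != 0.
Proof. by move=> zG; apply/negP => /no_eig. Qed.

(** By Cramer's rule the resolvent is the adjugate over the determinant, so every
    moment is a value of this linear functional of the numerator. *)
Definition det_moment p : R[i] :=
  two_pi_i^-1 * contour_integral G (fun z => p.[z] / d.[z]).

Lemma det_momentD p q : det_moment (p + q) = det_moment p + det_moment q.
Proof.
rewrite /det_moment -mulrDr -contour_integralD;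
  [|exact: contour_cont_ratio det_neq0_contour..].
apply: (congr1 (fun f => two_pi_i^-1 * contour_integral G f)).
by apply/funext => z; rewrite hornerD mulrDl.
Qed.

Lemma det_momentZ c p : det_moment (c *: p) = c * det_moment p.
Proof.
rewrite /det_moment mulrCA -(@contour_integralZ _ _ c);
  last exact: contour_cont_ratio det_neq0_contour.
apply: (congr1 (fun f => two_pi_i^-1 * contour_integral G f)).
by apply/funext => z; rewrite hornerZ mulrA.
Qed.

Lemma det_moment_sum (I : finType) (F : I -> {poly R[i]}) :
  det_moment (\sum_i F i) = \sum_i det_moment (F i).
Proof.
apply: (big_morph _ det_momentD).
by rewrite -(scale0r 0) det_momentZ mul0r.
Qed.

Lemma det_moment_mul_det p : det_moment (d * p) = 0.
Proof.
rewrite /det_moment (_ : contour_integral _ _ = 0) ?mulr0//.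
rewrite -(contour_integral_poly G p); apply: eq_contour_integral => z zG.
by rewrite hornerM mulrAC divff ?mul1r// det_neq0_contour.
Qed.

(** After cancellation of [D] only the exterior roots remain in the denominator. *)
Lemma det_moment_mul_interior D c rs p : c != 0 -> d = D * (c *: root_poly rs) ->
  {in rs, forall r, ~ contour_image G r /\ winding_integral G r = 0} ->
  det_moment (D * p) = 0.
Proof.
move=> c0 dE ext; rewrite /det_moment (_ : contour_integral _ _ = 0) ?mulr0//.
rewrite -(contour_integral_exterior_poles (c^-1 *: p) ext).
apply: eq_contour_integral => z zG; have := det_neq0_contour zG.
rewrite dE !hornerM !hornerZ !mulf_eq0 !negb_or => /and3P[D0 _ r0].
by field; rewrite c0 D0 r0.
Qed.

Definition adj_vec v : 'cV[{poly R[i]}]_n := \adj (mpoly_mx A) *m map_mx polyC v.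

Lemma resolvent_adj v z i : contour_image G z ->
  (invmx (mpoly_eval A z) *m v) i ord0 = (adj_vec v i ord0).[z] / d.[z].
Proof.
move=> zG; have d0 := det_neq0_contour zG.
rewrite /invmx unitmxE det_mpoly_eval unitfE d0 -scalemxAl mxE mulrC; congr (_ / _).
rewrite mpoly_eval_map -map_mx_adj.
have vE : map_mx (horner_eval z) (map_mx polyC v) = v.
  by apply/matrixP => a b; rewrite !mxE /horner_eval hornerC.
by rewrite -[in LHS]vE -map_mxM mxE.
Qed.

Lemma vector_momentE v k i :
  vector_moment A G v k i ord0 = det_moment ('X^k * adj_vec v i ord0).
Proof.
rewrite mxE /det_moment; congr (_ * _); apply: eq_contour_integral => z zG.
by rewrite mxE resolvent_adj// hornerM hornerXn mulrA.
Qed.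

Lemma scalar_momentE u v k :
  scalar_moment A G u v k = (map_mx conjc u^T *m vector_moment A G v k) ord0 ord0.
Proof.
rewrite mxE; under eq_bigr do rewrite vector_momentE -det_momentZ.
rewrite -det_moment_sum /scalar_moment /det_moment; congr (_ * _).
apply: eq_contour_integral => z zG; rewrite -mulmxA mxE horner_sum mulr_sumr mulr_suml.
apply: eq_bigr => j _; rewrite resolvent_adj// hornerZ hornerM hornerXn; ring.
Qed.

(** Multiplying the resolvent by the matrix polynomial cancels the denominator and
    leaves a polynomial, whose contour integral is 0. *)
Lemma vector_moment_recA v k :
  \sum_(j < l.+1) A j *m vector_moment A G v (j + k)%N = 0.
Proof.
apply/colP => i; rewrite summxE [RHS]mxE.
under eq_bigr => j _.
  rewrite mxE; under eq_bigr do rewrite vector_momentE -det_momentZ.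
  rewrite -det_moment_sum; over.
rewrite -det_moment_sum.
have : (mpoly_mx A *m adj_vec v) i ord0 = d * (v i ord0)%:P.
  by rewrite mulmxA mul_mx_adj mul_scalar_mx !mxE.
rewrite mxE => E; rewrite -[RHS](det_moment_mul_det ((v i ord0)%:P * 'X^k)) mulrA -E.
congr det_moment; rewrite exchange_big /= mulr_suml; apply: eq_bigr => t _.
rewrite summxE mulr_suml mulr_suml; apply: eq_bigr => j _.
by rewrite !mxE -mul_polyC exprD; ring.
Qed.

(** The factor [D] cancels the interior poles, so the moments satisfy the linear
    recurrence whose characteristic polynomial is [D]. *)
Lemma vector_moment_recD v D : (forall p, det_moment (D * p) = 0) ->
  forall k, \sum_(j < size D) D`_j *: vector_moment A G v (j + k)%N = 0.
Proof.
move=> D0 k; apply/colP => i; rewrite summxE [RHS]mxE.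
under eq_bigr => j _ do rewrite mxE vector_momentE -det_momentZ.
rewrite -det_moment_sum -[RHS](D0 ('X^k * adj_vec v i ord0)).
congr det_moment; rewrite -[in RHS](coefK D) poly_def mulr_suml.
by apply: eq_bigr => j _; rewrite exprD -!scalerAl mulrA.
Qed.

End MatrixPolynomialMoments.

(** * The invariant pair *)

Theorem theorem7 (R : realType) (n l : nat) (A : 'I_l.+1 -> 'M[R[i]]_n)
  (lead_neq0 : A ord_max != 0)
  (regular : mpoly_regular A)
  (G : closed_contour R)
  (u v : 'cV[R[i]]_n) (v_neq0 : v != 0)
  (m s : nat) (lam : 'I_s.+1 -> R[i]) (mult : 'I_s.+1 -> nat)
  (lam_inj : injective lam)
  (lam_interior : forall z : R[i],
     mpoly_eigenvalue A z /\ contour_interior G z <-> exists i, z = lam i)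
  (lam_mult : forall i, alg_mult A (lam i) = mult i)
  (m_sum : m = (\sum_(i < s.+1) mult i)%N)
  (no_eigenvalue_on_contour : forall z : R[i],
     mpoly_eigenvalue A z -> ~ contour_image G z)
  (lam_geom : forall i, geom_mult A (lam i) = 1%N)
  (H0_unit : hankel0 A G m u v \in unitmx) :
  let S := moment_mx A G m v in
  let C := invmx (hankel0 A G m u v) *m hankel1 A G m u v in
  mpoly_pair A S C = 0 /\ simple_invariant_pair A S C.
Proof.
set d := \det (mpoly_mx A) in regular *.
have [rs dE] := closed_field_poly_normal d.
have c_neq0 : lead_coef d != 0 by rewrite lead_coef_eq0.
pose inside := [pred z | z \in codom lam].
pose D := root_poly (seq.filter inside rs).
have D_monic : D \is monic by exact: monic_prod_XsubC.
have sizeD : (size D).-1 = size (seq.filter inside rs) by rewrite size_prod_XsubC.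
have m_le : ((size D).-1 <= l * n)%N.
  rewrite sizeD size_filter; apply: leq_trans (count_size _ _) _.
  have := size_det_mpoly A; rewrite -/d dE size_scale// size_prod_XsubC.
  by rewrite ltnS.
have count_inside z : z \in codom lam ->
    count_mem z (seq.filter inside rs) = count_mem z rs.
  move=> zin; rewrite count_filter; apply: eq_count => x /=.
  by case: eqP => // ->.
have mup_d z : alg_mult A z = count_mem z rs.
  rewrite /alg_mult -/d dE -mul_polyC mupMr ?mu_prod_XsubC//.
  by rewrite rootC.
have dDE : d = D * (lead_coef d *: root_poly (seq.filter (predC inside) rs)).
  rewrite [LHS]dE -scalerAr; congr (_ *: _).
  rewrite /D /root_poly -big_cat/=; apply: perm_big.
  by rewrite perm_sym perm_filterC.
have root_d z : mpoly_eigenvalue A z <-> z \in rs.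
  by rewrite /mpoly_eigenvalue -/d dE rootZ// root_prod_XsubC.
have exterior : {in seq.filter (predC inside) rs, forall z,
    ~ contour_image G z /\ winding_integral G z = 0}.
  move=> z; rewrite mem_filter => /andP[/= zN zrs]; have zeig := (root_d z).2 zrs.
  have nz := no_eigenvalue_on_contour _ zeig.
  split => //; apply: winding_integral_exterior => // zint.
  have [i zi] := (lam_interior z).1 (conj zeig zint).
  by rewrite zi codom_f in zN.
(* Cauchy's theorem enters here: [D] kills all poles of nonzero winding. *)
have D0 p : det_moment A G (D * p) = 0.
  exact: (det_moment_mul_interior no_eigenvalue_on_contour p c_neq0 dDE exterior).
(* Counting roots with multiplicity makes [D] a polynomial of degree [m]. *)
have mE : m = (size D).-1.
  rewrite sizeD size_filter count_codom// m_sum; apply: eq_bigr => i _.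
  by rewrite -lam_mult mup_d.
move: H0_unit; rewrite {m_sum}mE => H0_unit.
pose mom := vector_moment A G v.
have recD := vector_moment_recD no_eigenvalue_on_contour v D0.
have recA := vector_moment_recA no_eigenvalue_on_contour v.
pose w : 'rV_n := map_mx conjc u^T.
have SE : moment_mx A G (size D).-1 v = shift_mx D mom 0.
  by apply/matrixP => i j; rewrite [LHS]mxE [RHS]mxE (addn0 j).
have H0E : hankel0 A G (size D).-1 u v = shift_hankel D mom w 0.
  apply/matrixP => i j; rewrite [LHS]mxE [RHS]mxE (addn0 (i + j)%N).
  exact: (scalar_momentE no_eigenvalue_on_contour).
(* As [H1 = H0 C'] with [C'] the transposed companion of [D], [C] equals [C']. *)
have H1E : hankel1 A G (size D).-1 u v = shift_hankel D mom w 0 *m (companionmx D)^T.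
  apply: etrans (@shift_hankelS _ _ D mom w D_monic recD); apply/matrixP => i j.
  rewrite [LHS]mxE [RHS]mxE (addn1 (i + j)%N).
  exact: (scalar_momentE no_eigenvalue_on_contour).
rewrite H0E in H0_unit *; rewrite H1E SE (mulKmx H0_unit) => S C.
have PSC : mpoly_pair A S C = 0 := mpoly_pair_shift D_monic recD recA.
have char_C : char_poly C = D by rewrite /C char_poly_trmx companionmxK.
have m_gt0 : (0 < (size D).-1)%N.
  have [eig0 _] := (lam_interior (lam ord0)).2 (ex_intro _ ord0 erefl).
  rewrite sizeD size_filter -has_count; apply/hasP; exists (lam ord0).
    exact/root_d.
  exact: codom_f.
have minSC : minimal_pair S C := minimal_shift_pair D_monic recD H0_unit.
split; first exact: PSC.
split; [|exact: minSC|]; last first.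
  move=> z; rewrite eigenvalue_root_char char_C root_prod_XsubC mem_filter.
  move=> /andP[zin _]; rewrite mu_prod_XsubC mup_d.
  exact: count_inside.
split; [| |exact: PSC].
- apply/eqP => S0; have [r] := minSC; rewrite S0 => rk; move: m_gt0; rewrite -rk.
  rewrite (_ : \mxcol_(i < r) _ = 0) ?mxrank0 ?ltnn; first by [].
  by apply/matrixP => i j; rewrite [LHS]mxE mul0mx [LHS]mxE [RHS]mxE.
- by rewrite m_gt0 m_le.
Qed.
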